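(* Let $\beta \ge 1$ and $\epsilon \in (0,1)$, and let $f:[-1,1]\to\mathbb{R}$ be the Fermi–Dirac distribution $$f(x) = \frac{1}{e^{\beta x}+1}.$$ Then there is a polynomial $p_d$ of degree $d = O\!\left(\beta \log\frac{\beta}{\epsilon}\right)$ (with an absolute implied constant) such that $\|f - p_d\|_{[-1,1]} \le \epsilon$ and $\|p_d\|_{[-1,1]} \le 1+\epsilon$.
   Context: For a function $g$ on $[-1,1]$, $\|g\|_{[-1,1]} = \sup_{x\in[-1,1]} |g(x)|$ denotes the uniform norm. *)

(* Defs.v *)
From HB Require Import structures.
From mathcomp Require Import all_boot all_order all_algebra.
From mathcomp Require Import all_classical all_reals all_analysis.
Set Implicit Arguments. Unset Strict Implicit. Unset Printing Implicit Defensive.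
Import Order.TTheory GRing.Theory Num.Theory.
Local Open Scope ring_scope.

Definition fermi_dirac {R : realType} (beta x : R) : R :=
  1 / (expR (beta * x) + 1).

(* Main.v *)
Require Import Defs.
From HB Require Import structures.
From mathcomp Require Import all_boot all_order all_algebra.
From mathcomp Require Import all_classical all_reals all_analysis.
From mathcomp Require Import ring lra.
Import Order.TTheory GRing.Theory Num.Theory.
Local Open Scope ring_scope.

(* Write f(x) = 1/2 - tanh(beta x / 2) / 2 and, for N a large power of 2 and
   z = beta x / (2 N), approximate tanh(N z) by the normalized logarithmic
   derivative G of (1 + z)^N + (1 - z)^N, with error O(beta^2 / N).  This
   polynomial is a constant times a product of factors z^2 + t with t > 0, so
   G = (4 x / beta) * sum of the 1/(x^2 + b), where all b are >= 4/beta^2 and the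
   sum of the 1/b is <= beta^2/4.  With T_n the n-th Chebyshev polynomial,
   (1 - T_n(1 - 2 x^2) / T_n(1 + 2 b)) / (x^2 + b) is a polynomial in x^2 of
   degree < n approximating 1/(x^2 + b) with error 1/(b T_n(1 + 2 b)), which is
   exponentially small in n / beta.  The degree depends only on the smallest b,
   not on N, so N can be taken as large as eps requires. *)

(** * Partial fractions of the logarithmic derivative *)

(* Half-angle recursion: with c = 2 c'^2 - 1,
   A^4 - 2 c A^2 B^2 + B^4 = (A^2 - 2 c' A B + B^2) (A^2 + 2 c' A B + B^2). *)
Lemma trinomial_factorization (R : rcfType) (m : nat) (c : R) : -1 < c < 1 ->
  exists2 s : seq R, all (fun d => -1 < d < 1) s &
  forall X Y : {poly R},
    X ^+ (2 ^ m.+1) - 2 * c%:P * (X * Y) ^+ (2 ^ m) + Y ^+ (2 ^ m.+1) =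
    \prod_(d <- s) (X ^+ 2 - 2 * d%:P * (X * Y) + Y ^+ 2).
Proof.
elim: m c => [|m IHm] c c1.
  by exists [:: c]; [rewrite /= c1 | move=> X Y; rewrite big_seq1 expr1].
have /andP[c_gt c_lt] := c1.
pose c' := Num.sqrt ((1 + c) / 2).
have c'2 : c' ^+ 2 = (1 + c) / 2 by rewrite sqr_sqrtr //; lra.
have c'_ge0 : 0 <= c' := sqrtr_ge0 _.
have c'_lt1 : c' < 1 by rewrite -(@ltr_pXn2r _ 2) ?nnegrE // c'2 expr1n; lra.
have [|s1 s1P E1] := IHm c'; first by apply/andP; split; lra.
have [|s2 s2P E2] := IHm (- c'); first by apply/andP; split; lra.
exists (s1 ++ s2); first by rewrite all_cat s1P.
move=> X Y; rewrite big_cat /= -E1 -E2 polyCN.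
have -> : c%:P = 2 * c'%:P ^+ 2 - 1 :> {poly R}.
  rewrite -polyC_exp c'2 -[2]polyC_natr -polyCM mulrCA divff ?mulr1 //.
  by rewrite polyCD polyC1 addrC addKr.
by rewrite !expnS !exprM !exprMn; set x := X ^+ _; ring.
Qed.

(** Substituting 1 + X and 1 - X in [trinomial_factorization] turns the factor of parameter d into 2
    (1 + d) X^2 + 2 (1 - d), whence t = (1 - d) / (1 + d). *)
Lemma sum_pow_factorization (R : rcfType) (m : nat) :
  exists2 ks : R * seq R, ks.1 != 0 /\ all (fun t => 0 < t) ks.2 &
  (1 + 'X) ^+ (2 ^ m.+1) + (1 - 'X) ^+ (2 ^ m.+1) =
  ks.1 *: \prod_(t <- ks.2) ('X ^+ 2 + t%:P).
Proof.
have [|s sP E] := @trinomial_factorization R m 0; first by apply/andP; split; lra.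
have := E (1 + 'X) (1 - 'X); rewrite polyC0 mulr0 mul0r subr0 => ->.
exists (\prod_(c <- s) (2 * (1 + c)), [seq (1 - c) / (1 + c) | c <- s]) => /=.
  split.
    rewrite prodf_seq_neq0; apply/allP => c /(allP sP) /andP[c_gt _] /=.
    by rewrite gt_eqF //; lra.
  rewrite all_map; apply/allP => c /(allP sP) /andP[c_gt c_lt] /=.
  by apply: divr_gt0; lra.
rewrite big_map.
elim: s sP {E} => [|c s IHs] /=; first by rewrite !big_nil scale1r.
move=> /andP[/andP[c_gt c_lt] sP]; rewrite !big_cons IHs //.
rewrite -scalerA [in RHS]scalerAr scalerAl; congr (_ * _).
have E : (1 - c)%:P = (1 + c)%:P * ((1 - c) / (1 + c))%:P :> {poly R}.
  by rewrite -polyCM; congr _%:P; field; rewrite gt_eqF //; lra.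
set q := (_ / _)%:P in E *.
rewrite -mul_polyC polyCM polyC_natr.
transitivity (2 * ((1 + c)%:P * 'X ^+ 2 + (1 - c)%:P)); last by rewrite E; ring.
by rewrite polyCB polyCD !polyC1; ring.
Qed.

Lemma deriv_prod_quadratics (R : realFieldType) (s : seq R) (z : R) :
  all (fun t => 0 < t) s ->
  (\prod_(t <- s) ('X ^+ 2 + t%:P))^`().[z] =
  (\prod_(t <- s) ('X ^+ 2 + t%:P)).[z] * \sum_(t <- s) 2 * z / (z ^+ 2 + t).
Proof.
elim: s => [|t s IHs] /=; first by rewrite !big_nil derivC horner0 mulr0.
move=> /andP[t_gt0 /IHs E].
have zt : z ^+ 2 + t != 0 by rewrite gt_eqF // ltr_wpDl // sqr_ge0.
rewrite !big_cons derivM !hornerE E /= derivD derivC addr0 derivXn !hornerE /=.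
by field.
Qed.

Lemma deriv_sum_pow (R : comNzRingType) (n : nat) (z : R) :
  ((1 + 'X) ^+ n + (1 - 'X) ^+ n)^`().[z] =
  n%:R * ((1 + z) ^+ n.-1 - (1 - z) ^+ n.-1).
Proof.
rewrite derivD !deriv_exp derivB derivD derivX -polyC1 derivC add0r sub0r.
by rewrite !hornerE !hornerMn !hornerE mulr_natl mulrnBl mulN1r mulNrn.
Qed.

(** Both sides are logarithmic derivatives of the two forms in [sum_pow_factorization]; the constant
    factor cancels. *)
Lemma partial_fractions (R : rcfType) (m : nat) (N := (2 ^ m.+1)%N) :
  exists2 s : seq R, all (fun t => 0 < t) s & forall z : R, -1 < z < 1 ->
  \sum_(t <- s) 2 * z / (z ^+ 2 + t) =
  N%:R * ((1 + z) ^+ N.-1 - (1 - z) ^+ N.-1) / ((1 + z) ^+ N + (1 - z) ^+ N).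
Proof.
have [[k s] /= [k0 sP] E] := sum_pow_factorization R m.
exists s => // z /andP[z_gt z_lt].
have D_gt0 : 0 < (1 + z) ^+ N + (1 - z) ^+ N.
  by apply: addr_gt0; apply: exprn_gt0; lra.
apply/(canRL (mulfK (lt0r_neq0 D_gt0))).
have := congr1 (horner^~ z) E; rewrite !hornerE /= -/N => ->.
rewrite mulrCA (mulrC (\sum_(_ <- _) _)) -deriv_prod_quadratics //.
have := congr1 (fun p : {poly R} => p^`().[z]) E.
rewrite derivZ hornerZ => <-.
by rewrite deriv_sum_pow.
Qed.

(** After the change of scale z = beta x / (2 N), these bounds on t and on the sum of the 1/t no
    longer involve N. *)
Lemma partial_fractions_bounds (R : rcfType) (m : nat) (N := (2 ^ m.+1)%N) :
  exists s : seq R, [/\ all (fun t => N%:R ^- 2 <= t) s,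
    \sum_(t <- s) t^-1 <= N%:R ^+ 2 &
  forall z : R, -1 < z < 1 -> \sum_(t <- s) 2 * z / (z ^+ 2 + t) =
  N%:R * ((1 + z) ^+ N.-1 - (1 - z) ^+ N.-1) / ((1 + z) ^+ N + (1 - z) ^+ N)].
Proof.
have [s sP E] := partial_fractions R m; rewrite -/N in E.
have N2 : 2 <= N%:R :> R by rewrite ler_nat /N expnS leq_pmulr ?expn_gt0.
have N_gt0 : 0 < N%:R :> R by lra.
(* At z = 1/N the right-hand side of E is at most N, which bounds the sum of
   the 1/(1/N^2 + t), hence each t from below, hence the sum of the 1/t. *)
set z : R := N%:R^-1.
have zN : z * N%:R = 1 by rewrite mulVf // gt_eqF.
have z_gt0 : 0 < z by rewrite invr_gt0.
have z_lt1 : z < 1 by rewrite invf_lt1 //; lra.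
have z1 : -1 < z < 1 by apply/andP; split; lra.
have S_le : \sum_(t <- s) (z ^+ 2 + t)^-1 <= N%:R ^+ 2 / 2.
  have -> : \sum_(t <- s) (z ^+ 2 + t)^-1 =
      (N%:R / 2) * \sum_(t <- s) 2 * z / (z ^+ 2 + t).
    rewrite mulr_sumr; apply: eq_bigr => t _.
    transitivity (z * N%:R * (z ^+ 2 + t)^-1); first by rewrite zN mul1r.
    by set w := _^-1; field.
  rewrite E // -[X in _ / 2 * X]mulrA.
  have -> (w : R) : N%:R / 2 * (N%:R * w) = N%:R ^+ 2 / 2 * w by field.
  rewrite ler_piMr ?divr_ge0 ?sqr_ge0 //.
  have A0 : 0 < (1 - z) ^+ N.-1 by apply: exprn_gt0; lra.
  have B0 : 0 < (1 - z) ^+ N by apply: exprn_gt0; lra.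
  have C0 : 0 < (1 + z) ^+ N by apply: exprn_gt0; lra.
  rewrite ler_pdivrMr ?mul1r ?addr_gt0 //.
  have : (1 + z) ^+ N.-1 <= (1 + z) ^+ N.
    by rewrite ler_weXn2l ?leq_pred //; lra.
  lra.
(* A single summand is at most N^2 / 2 = 1 / (2 z^2), so z^2 + t >= 2 z^2. *)
have t_ge t : t \in s -> z ^+ 2 <= t.
  move=> ts; have t_gt0 := allP sP _ ts.
  have z2t : 0 < z ^+ 2 + t by rewrite ltr_wpDl // sqr_ge0.
  have : (z ^+ 2 + t)^-1 <= N%:R ^+ 2 / 2.
    apply: le_trans S_le; rewrite (big_rem t) //= lerDl big_seq sumr_ge0 // => u us.
    by rewrite invr_ge0 addr_ge0 ?sqr_ge0 // ltW // (allP sP) // (mem_rem us).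
  rewrite -[(N%:R ^+ 2 / 2)]invrK lef_pV2 ?posrE ?invr_gt0 ?divr_gt0 ?exprn_gt0 //.
  by rewrite invf_div -[2 / _]/(2 * _) -exprVn -/z; lra.
exists s; split=> //; first by apply/allP => t ts /=; rewrite -exprVn t_ge.
(* Since z^2 <= t, each 1/t is at most 2 / (z^2 + t). *)
have -> : N%:R ^+ 2 = 2 * (N%:R ^+ 2 / 2) :> R by field.
apply: le_trans (_ : 2 * \sum_(t <- s) (z ^+ 2 + t)^-1 <= _); last by rewrite ler_pM2l.
rewrite mulr_sumr big_seq [leRHS]big_seq ler_sum // => t ts.
have t_gt0 := allP sP _ ts; have := t_ge _ ts => zt.
have z2t : 0 < z ^+ 2 + t by rewrite ltr_wpDl // sqr_ge0.
rewrite -[2 * _]invrK lef_pV2 ?posrE ?invr_gt0 ?mulr_gt0 ?invr_gt0 //.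
by rewrite invfM invrK; lra.
Qed.

(** * Chebyshev approximation of 1 / (s + b) *)

(* The pair (T_n, U_(n-1)) of Chebyshev polynomials, with U_(-1) = 0. *)
Fixpoint chebyshev (R : nzRingType) (n : nat) : {poly R} * {poly R} :=
  if n is n'.+1 then
    let: (T, U) := chebyshev R n' in ('X * T - (1 - 'X ^+ 2) * U, 'X * U + T)
  else (1, 0).

Lemma size_chebyshev (R : nzRingType) (n : nat) :
  (size (chebyshev R n).1 <= n.+1)%N /\ (size (chebyshev R n).2 <= n)%N.
Proof.
elim: n => [|n] /=; first by rewrite size_poly1 size_poly0.
case: (chebyshev R n) => T U /= [sT sU].
have s2 : (size (1 - 'X ^+ 2 : {poly R})%R <= 3)%N.
  by rewrite (leq_trans (size_polyD _ _)) // size_poly1 size_polyN size_polyXn.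
split; rewrite (leq_trans (size_polyD _ _)) // geq_max ?size_polyN.
  rewrite !(leq_trans (size_polyMleq _ _)) ?size_polyX //=.
  by rewrite -ltnS -(leq_add2l 3) in sU; apply: leq_trans (_ : (3 + n).-1 <= _)%N => //;
     rewrite -!subn1 leq_sub2r // leq_add // -ltnS.
by rewrite sT (leq_trans (size_polyMleq _ _)) ?size_polyX.
Qed.

(** The recursion multiplies T + w U by x + w, where w^2 = x^2 - 1; since x + w has norm 1, the norm
    T^2 - w^2 U^2 is preserved. *)
Lemma chebyshev_pell (R : comNzRingType) (n : nat) (x : R) :
  (chebyshev R n).1.[x] ^+ 2 + (1 - x ^+ 2) * (chebyshev R n).2.[x] ^+ 2 = 1.
Proof.
elim: n => [|n] /=; first by rewrite hornerC horner0; ring.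
case: (chebyshev R n) => T U /= E; rewrite !hornerE /=. rewrite -[RHS]E; ring.
Qed.

Lemma chebyshev_le1 (R : realFieldType) (n : nat) (x : R) :
  -1 <= x <= 1 -> `|(chebyshev R n).1.[x]| <= 1.
Proof.
move=> /andP[x_ge x_le]; rewrite -(@expr_le1 _ 2) // real_normK ?num_real //.
rewrite -[leRHS](chebyshev_pell _ n x) lerDl mulr_ge0 ?sqr_ge0 //; nra.
Qed.

Lemma chebyshev_expr (R : comNzRingType) (n : nat) (x y : R) :
  y ^+ 2 = x ^+ 2 - 1 ->
  (chebyshev R n).1.[x] + y * (chebyshev R n).2.[x] = (x + y) ^+ n.
Proof.
move=> y2; elim: n => [|n] /=; first by rewrite hornerC horner0; ring.
case: (chebyshev R n) => T U /= E; rewrite [RHS]exprS -E !hornerE /=.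
have -> : 1 - x ^+ 2 = - y ^+ 2 by rewrite y2 opprB.
ring.
Qed.

(** With x = 1 + 2 b and y = sqrt(x^2 - 1) = 2 sqrt(b^2 + b) >= 2 h, [chebyshev_expr] at y and -y
    gives 2 T_n(x) = (x + y)^n + (x - y)^n, where x >= y and x + y >= 1 + 2 h. *)
Lemma chebyshev_ge (R : rcfType) (n : nat) (b h : R) : 0 <= h -> h ^+ 2 <= b ->
  (1 + 2 * h) ^+ n / 2 <= (chebyshev R n).1.[1 + 2 * b].
Proof.
move=> h0 hb; set x := 1 + 2 * b.
have b0 : 0 <= b by apply: le_trans hb; exact: sqr_ge0.
have x2 : 0 <= x ^+ 2 - 1 by rewrite /x; nra.
set y := Num.sqrt (x ^+ 2 - 1).
have y2 : y ^+ 2 = x ^+ 2 - 1 by rewrite sqr_sqrtr.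
have y0 : 0 <= y by exact: sqrtr_ge0.
have hy : 2 * h <= y.
  rewrite -(@ler_pXn2r _ 2) ?nnegrE ?mulr_ge0 // y2 /x; nra.
have Ep := @chebyshev_expr R n x y y2.
have En := @chebyshev_expr R n x (- y).
rewrite sqrrN in En; have {}En := En y2.
have : (1 + 2 * h) ^+ n <= (x + y) ^+ n.
  by rewrite lerXn2r ?nnegrE //; rewrite /x; lra.
have : 0 <= (x - y) ^+ n.
  apply: exprn_ge0; rewrite subr_ge0 -(@ler_pXn2r _ 2) ?nnegrE //; first by rewrite y2; lra.
  by rewrite /x; lra.
move: Ep En; rewrite mulNr; lra.
Qed.

Lemma inverse_shift_approx (R : rcfType) (n : nat) (b h : R) :
  0 < h -> h ^+ 2 <= b ->
  exists2 q : {poly R}, (size q <= n)%N &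
  forall s : R, 0 <= s <= 1 ->
    `|(s + b)^-1 - q.[s]| <= 2 / (1 + 2 * h) ^+ n / b.
Proof.
move=> h0 hb.
have b0 : 0 < b by apply: lt_le_trans hb; exact: exprn_gt0.
have := @chebyshev_ge R n b h (ltW h0) hb; set W := horner _ _ => W_ge.
have Hn : 0 < (1 + 2 * h) ^+ n by apply: exprn_gt0; lra.
have W0 : 0 < W by lra.
pose t := 1 - W^-1 *: ((chebyshev R n).1 \Po (1 - 2 *: 'X)).
have tE s : t.[s] = 1 - W^-1 * (chebyshev R n).1.[1 - 2 * s].
  by rewrite !hornerE horner_comp !hornerE.
have st : (size t <= n.+1)%N.
  rewrite (leq_trans (size_polyD _ _)) // size_poly1 size_polyN geq_max /=.
  rewrite (leq_trans (size_scale_leq _ _)) // (leq_trans (size_comp_poly_leq _ _)) //.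
  rewrite ltnS (_ : (size (1 - 2 *: 'X : {poly R})%R).-1 = 1%N) ?muln1.
    by have [+ _] := size_chebyshev R n; case: (size _).
  by rewrite addrC size_polyDl ?size_polyN ?size_scale ?size_polyX ?size_poly1 ?pnatr_eq0.
(* W is the value of T_n at 1 + 2 b = 1 - 2 (-b), so X + b divides t. *)
have /factor_theorem[q Eq] : root t (- b).
  by rewrite rootE tE mulrN opprK -/W mulVf ?subrr // gt_eqF.
exists q.
  have [->|q0] := eqVneq q 0; first by rewrite size_poly0.
  by move: st; rewrite Eq size_Mmonic ?monicXsubC // size_XsubC addn2.
move=> s /andP[s0 s1]; have sb : 0 < s + b by lra.
have -> : (s + b)^-1 - q.[s] = W^-1 * (chebyshev R n).1.[1 - 2 * s] / (s + b).
  apply/(canRL (mulfK (lt0r_neq0 sb))); rewrite mulrBl mulVf ?gt_eqF //.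
  have := tE s; rewrite Eq hornerM hornerXsubC opprK => ->.
  by rewrite opprB addrCA subrr addr0.
rewrite !normrM !normfV (gtr0_norm W0) (gtr0_norm sb) ler_pM //.
- by rewrite mulr_ge0 ?invr_ge0 // ltW.
- by rewrite invr_ge0 ltW.
- apply: le_trans (_ : W^-1 * 1 <= _).
    rewrite ler_pM2l ?invr_gt0 // chebyshev_le1 //; apply/andP; split; lra.
  rewrite mulr1 -[leRHS]invrK lef_pV2 ?posrE ?invr_gt0 ?divr_gt0 //.
  by rewrite invf_div.
- by rewrite lef_pV2 ?posrE //; lra.
Qed.

(** * Powers of 1 + z against exponentials *)

Lemma expR_le1Dx (R : realType) (z : R) : - 2^-1 <= z ->
  expR (z - 2 * z ^+ 2) <= 1 + z.
Proof.
move=> z_ge; have z1 : 0 < 1 + z by lra.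
(* For w = z / (1 + z), the inequality exp(-w) >= 1 - w reads exp(w) <= 1 + z, and w >= z - 2 z^2
   amounts to z^2 (1 + 2 z) >= 0. *)
apply: le_trans (_ : expR (z / (1 + z)) <= _).
  rewrite ler_expR ler_pdivlMr //; nra.
rewrite -[leRHS]invrK -[leLHS]invrK -expRN lef_pV2 ?posrE ?invr_gt0 ?expR_gt0 //.
apply: le_trans (expR_ge1Dx _).
by rewrite le_eqVlt; apply/orP; left; apply/eqP; field; rewrite gt_eqF.
Qed.

(** The factor on the left comes from exp(-2 N z^2) >= 1 - 2 N z^2. *)
Lemma pow_expR_bounds (R : realType) (N : nat) (z : R) : - 2^-1 <= z ->
  (1 - 2 * N%:R * z ^+ 2) * expR (N%:R * z) <= (1 + z) ^+ N <= expR (N%:R * z).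
Proof.
move=> z_ge; apply/andP; split; last first.
  by rewrite expRM_natl lerXn2r ?nnegrE ?expR_ge0 ?expR_ge1Dx //; lra.
apply: le_trans (_ : expR (N%:R * (z - 2 * z ^+ 2)) <= _); last first.
  by rewrite expRM_natl lerXn2r ?nnegrE ?expR_ge0 ?expR_le1Dx //; lra.
rewrite mulrBr expRD mulrC ler_wpM2l ?expR_ge0 //.
have -> : 2 * N%:R * z ^+ 2 = N%:R * (2 * z ^+ 2) by ring.
exact: expR_ge1Dx.
Qed.

(** Let a, b be exp(N z), exp(-N z), let u, v be (1 + z)^N, (1 - z)^N, and u', v' the same powers
    with exponent N - 1. Then f = b / (a + b) is within 2 N z^2 of v / (u + v). The exponents N - 1
    add z (u' + v') / (2 (u + v)), of size at most |z| because u >= u' / 2 and v >= v' / 2. *)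
Lemma fermi_dirac_rational_approx (R : realType) (N : nat) (beta x : R)
    (z := beta * x / 2 / N%:R) : (0 < N)%N -> `|z| <= 2^-1 ->
  `|fermi_dirac beta x - (2^-1 - 2^-1 *
     (((1 + z) ^+ N.-1 - (1 - z) ^+ N.-1) / ((1 + z) ^+ N + (1 - z) ^+ N)))|
  <= 2 * N%:R * z ^+ 2 + `|z|.
Proof.
move=> N0 z_le; have /andP[z_ge z_le'] : - 2^-1 <= z <= 2^-1 by rewrite -ler_norml.
have NR : 0 < N%:R :> R by rewrite ltr0n.
have Nz : N%:R * z = beta * x / 2 by rewrite mulrC divfK // gt_eqF.
have := @pow_expR_bounds R N z z_ge.
have := @pow_expR_bounds R N (- z); rewrite lerN2 mulrN => /(_ z_le').
have a_gt0 := expR_gt0 (N%:R * z); have b_gt0 := expR_gt0 (- (N%:R * z)).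
have -> : fermi_dirac beta x =
    expR (- (N%:R * z)) / (expR (N%:R * z) + expR (- (N%:R * z))).
  rewrite /fermi_dirac (_ : beta * x = N%:R * z + N%:R * z); last by rewrite Nz; field.
  rewrite expRD expRN; field.
  by rewrite !gt_eqF ?expR_gt0 // addr_gt0 // mulr_gt0.
rewrite sqrrN; move: a_gt0 b_gt0.
set a := expR _; set b := expR _; set d := 2 * N%:R * z ^+ 2.
move=> a_gt0 b_gt0 /andP[v_ge v_le] /andP[u_ge u_le].
have u'_gt0 : 0 < (1 + z) ^+ N.-1 by apply: exprn_gt0; lra.
have v'_gt0 : 0 < (1 - z) ^+ N.-1 by apply: exprn_gt0; lra.
have Eu : (1 + z) ^+ N = (1 + z) * (1 + z) ^+ N.-1 by rewrite -exprS prednK.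
have Ev : (1 - z) ^+ N = (1 - z) * (1 - z) ^+ N.-1 by rewrite -exprS prednK.
have u_gt0 : 0 < (1 + z) ^+ N by apply: exprn_gt0; lra.
have v_gt0 : 0 < (1 - z) ^+ N by apply: exprn_gt0; lra.
move: Eu Ev u'_gt0 v'_gt0 u_gt0 v_gt0 u_ge u_le v_ge v_le.
set u := _ ^+ N; set v := _ ^+ N; set u' := _ ^+ N.-1; set v' := _ ^+ N.-1.
move=> Eu Ev u'_gt0 v'_gt0 u_gt0 v_gt0 u_ge u_le v_ge v_le.
have d_ge0 : 0 <= d by apply: mulr_ge0; [apply: mulr_ge0; lra | exact: sqr_ge0].
have ab_gt0 : 0 < a + b by lra.
have uv_gt0 : 0 < u + v by lra.
have -> : 2^-1 - 2^-1 * ((u' - v') / (u + v)) =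
    v / (u + v) + z * ((u' + v') / (u + v) / 2).
  have -> : 2^-1 = (u + v) / (u + v) / 2 by rewrite divff ?gt_eqF // mul1r.
  by field: Eu Ev; rewrite gt_eqF.
rewrite opprD addrA; apply: le_trans (ler_normB _ _) _; apply: lerD; last first.
  rewrite normrM ler_piMr // ger0_norm; last by rewrite !divr_ge0 //; lra.
  by rewrite ler_pdivrMr // ler_pdivrMr // Eu Ev; nra.
(* Applied to v against b and to u against a. Each pair of fractions sums to 1, so the two lower
   bounds give a two-sided one. *)
have lower (p q : R) : 0 < p -> p <= a + b -> (1 - d) * q <= p -> 0 <= q -> q <= a + b ->
    p <= u + v -> q / (a + b) - d <= p / (u + v).
  move=> p_gt0 p_le qp q_ge0 q_le puv.
  apply: le_trans (_ : p / (a + b) <= _); last first.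
    by rewrite ler_pM2l // lef_pV2 ?posrE //; lra.
  rewrite ler_pdivlMr // mulrBl divfK ?gt_eqF //; nra.
have Lv : b / (a + b) - d <= v / (u + v) by apply: lower; lra.
have Lu : a / (a + b) - d <= u / (u + v) by apply: lower; lra.
have : a / (a + b) + b / (a + b) = 1 by rewrite -mulrDl divff // gt_eqF.
have : u / (u + v) + v / (u + v) = 1 by rewrite -mulrDl divff // gt_eqF.
by move=> ? ?; rewrite ler_norml; apply/andP; split; lra.
Qed.

(** * Assembly of the polynomial and choice of its degree *)

Lemma sum_inverse_shift_approx (R : rcfType) (n : nat) (h : R) (bs : seq R) :
  0 < h -> all (fun b => h ^+ 2 <= b) bs ->
  exists2 q : {poly R}, (size q <= n)%N &
  forall s : R, 0 <= s <= 1 ->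
    `|\sum_(b <- bs) (s + b)^-1 - q.[s]| <=
    2 / (1 + 2 * h) ^+ n * \sum_(b <- bs) b^-1.
Proof.
move=> h_gt0; elim: bs => [|b bs IHbs] /=.
  move=> _; exists 0 => [|s _]; first by rewrite size_poly0.
  by rewrite !big_nil horner0 subrr normr0 mulr0.
move=> /andP[/(inverse_shift_approx _ n b _ h_gt0)[q1 q1n q1P] /IHbs[q q_n qP]].
exists (q1 + q) => [|s s01].
  by rewrite (leq_trans (size_polyD _ _)) // geq_max q1n.
rewrite !big_cons mulrDr hornerD opprD addrACA.
by apply: le_trans (ler_normD _ _) (lerD _ _); [exact: q1P | exact: qP].
Qed.

(** From exp(-w) >= 1 - w at w = 1 / (beta + 1) one gets 1 + 1/beta >= exp(1 / (beta + 1)), and beta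
    + 1 <= 2 beta. *)
Lemma pow_1Dinv_ge (R : realType) (n : nat) (beta : R) : 1 <= beta ->
  expR (n%:R / (2 * beta)) <= (1 + beta^-1) ^+ n.
Proof.
move=> beta1; have beta_gt0 : 0 < beta by lra.
have binv : 0 < beta^-1 by rewrite invr_gt0.
rewrite expRM_natl lerXn2r ?nnegrE ?expR_ge0 //; first by lra.
apply: le_trans (_ : expR (beta + 1)^-1 <= _).
  by rewrite ler_expR lef_pV2 ?posrE; lra.
rewrite -[leRHS]invrK -[leLHS]invrK -expRN lef_pV2 ?posrE ?invr_gt0 ?expR_gt0 //.
  apply: le_trans (expR_ge1Dx _).
  by rewrite le_eqVlt; apply/orP; left; apply/eqP; field; rewrite !gt_eqF //; lra.
by lra.
Qed.

Lemma ln2_ge_half (R : realType) : 2^-1 <= ln 2 :> R.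
Proof.
rewrite -ler_expR lnK ?posrE // -[leRHS]invrK -[leLHS]invrK -expRN.
rewrite lef_pV2 ?posrE ?invr_gt0 ?expR_gt0 //.
by apply: le_trans (expR_ge1Dx _); lra.
Qed.

Lemma fermi_dirac_bounds (R : realType) (beta x : R) :
  0 < fermi_dirac beta x < 1.
Proof.
have e := expR_gt0 (beta * x).
rewrite /fermi_dirac divr_gt0 ?ltr_pdivrMr ?mul1r; lra.
Qed.

Lemma fermi_dirac_poly_approx (R : realType) (beta eps : R) (n : nat) :
  1 <= beta -> 0 < eps -> eps <= 1 -> 2 * beta * ln (2 * beta / eps) <= n%:R ->
  exists2 p : {poly R}, (size p <= (2 * n).+2)%N &
  forall x, -1 <= x <= 1 -> `|fermi_dirac beta x - p.[x]| <= eps.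
Proof.
move=> beta1 eps_gt0 eps_le1 n_ge.
have beta_gt0 : 0 < beta by lra.
(* Then N = 2^(m+1) > m + 1 > 2 beta^2 / eps, so that beta^2 / N <= eps / 2. *)
pose m := Num.truncn (2 * beta ^+ 2 / eps).
have := @partial_fractions_bounds R m; set N := (2 ^ m.+1)%N.
move=> [ts [ts_ge ts_sum ts_frac]].
have N_ge : 2 * beta ^+ 2 / eps <= N%:R.
  apply: le_trans (ltW (truncnS_gt _)) _.
  by rewrite ler_nat ltnW // ltn_expl.
have N_gt0 : 0 < N%:R :> R by rewrite ltr0n expn_gt0.
(* Since z = k x, the shift t of z^2 becomes the shift b = t / k^2 of x^2. *)
set k := beta / 2 / N%:R; have k_gt0 : 0 < k by rewrite !divr_gt0.
(* The bound b >= 4 / beta^2 would allow h up to 2 / beta; this smaller h makes 1 + 2 h the base 1 +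
   1/beta of [pow_1Dinv_ge]. *)
have h_gt0 : 0 < (2 * beta)^-1 by rewrite invr_gt0; lra.
have := @sum_inverse_shift_approx R n _ [seq t / k ^+ 2 | t <- ts] h_gt0.
rewrite !big_map => -[|q q_size qP].
  rewrite all_map; apply/allP => t /(allP ts_ge) /= t_ge.
  rewrite ler_pdivlMr ?exprn_gt0 //; apply: le_trans t_ge.
  have hk : (2 * beta)^-1 * k <= N%:R^-1.
    have -> : (2 * beta)^-1 * k = 4^-1 * N%:R^-1.
      by rewrite /k; field; rewrite !gt_eqF.
    by rewrite ler_piMl ?invr_ge0 ?ler0n //; lra.
  rewrite -exprMn -exprVn lerXn2r ?nnegrE ?invr_ge0 ?ler0n //.
  by rewrite mulr_ge0 // ltW.
(* This is (1 - G) / 2 with the sum of the 1 / (x^2 + b) in G replaced by q(x^2). *)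
exists (2^-1%:P - (2 / beta) *: ('X * (q \Po 'X^2))).
  rewrite (leq_trans (size_polyD _ _)) // geq_max size_polyN.
  rewrite (leq_trans (size_polyC_leq1 _)) //=.
  rewrite (leq_trans (size_scale_leq _ _)) // (leq_trans (size_polyMleq _ _)) //.
  rewrite size_polyX !ltnS (leq_trans (size_comp_poly_leq _ _)) //.
  by rewrite size_polyXn ltnS mulnC leq_mul2l (leq_trans (leq_pred _)).
move=> x x1; have /andP[x_ge x_le] := x1.
have x_norm : `|x| <= 1 by rewrite ler_norml x1.
set z := beta * x / 2 / N%:R.
have zk : z = k * x by rewrite /z /k; field; rewrite gt_eqF.
have betaN : beta ^+ 2 / N%:R <= eps / 2.
  by move: N_ge; rewrite !ler_pdivrMr ?ler_pdivlMr //; lra.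
have z_le : `|z| <= k by rewrite zk normrM (gtr0_norm k_gt0) ler_piMr // ltW.
have z_small : `|z| <= 2^-1.
  apply: (le_trans z_le); rewrite /k ler_pdivrMr //.
  move: N_ge; rewrite ler_pdivrMr // => N_ge.
  have : N%:R * eps <= N%:R by rewrite ler_piMr // ltW.
  nra.
rewrite -[fermi_dirac _ _ - _](subrKA (2^-1 - 2^-1 *
  (((1 + z) ^+ N.-1 - (1 - z) ^+ N.-1) / ((1 + z) ^+ N + (1 - z) ^+ N)))).
have -> : eps = eps / 2 + eps / 2 by lra.
apply: le_trans (ler_normD _ _) (lerD _ _).
  apply: le_trans (fermi_dirac_rational_approx _ _ _ _ _ z_small) _.
    by rewrite expn_gt0.
  apply: le_trans betaN; rewrite -/z -real_normK ?num_real //.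
  apply: le_trans (_ : 2 * N%:R * k ^+ 2 + k <= _).
    by rewrite lerD // ler_pM2l ?mulr_gt0 // lerXn2r ?nnegrE // ltW.
  (* As beta >= 1, this is at most beta^2 / N. *)
  have -> : 2 * N%:R * k ^+ 2 + k = (beta ^+ 2 / 2 + beta / 2) / N%:R.
    by rewrite /k; field; rewrite gt_eqF.
  by rewrite ler_pM2r ?invr_gt0 //; nra.
have z1 : -1 < z < 1 by move: z_small; rewrite ler_norml; lra.
have x2 : 0 <= x ^+ 2 <= 1 by apply/andP; split; nra.
have sumE : ((1 + z) ^+ N.-1 - (1 - z) ^+ N.-1) / ((1 + z) ^+ N + (1 - z) ^+ N) =
    4 / beta * (x * \sum_(t <- ts) (x ^+ 2 + t / k ^+ 2)^-1).
  have := ts_frac z z1.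
  rewrite -mulrA => /(canLR (mulKf (lt0r_neq0 N_gt0))) <-.
  rewrite !mulr_sumr [in LHS]big_seq [in RHS]big_seq; apply: eq_bigr => t tts.
  have t_gt0 : 0 < t by apply: lt_le_trans (allP ts_ge _ tts); rewrite -exprVn exprn_gt0 ?invr_gt0.
  rewrite zk /k; field.
  by rewrite !gt_eqF // ltr_wpDl ?sqr_ge0 // !mulr_gt0.
have := qP _ x2; rewrite big_map; set S := \sum_(j <- ts) (_ + _)^-1 => SP.
have -> : (2^-1%:P - (2 / beta) *: ('X * (q \Po 'X^2))).[x] =
    2^-1 - 2 / beta * (x * q.[x ^+ 2]).
  by rewrite !hornerE horner_comp !hornerE.
rewrite sumE -/S.
have -> : 2^-1 - 2^-1 * (4 / beta * (x * S)) - (2^-1 - 2 / beta * (x * q.[x ^+ 2])) =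
  - (2 / beta * x * (S - q.[x ^+ 2])) by field; rewrite gt_eqF.
rewrite normrN -mulrA normrM gtr0_norm ?divr_gt0 // normrM.
have sum_le : \sum_(j <- ts) (j / k ^+ 2)^-1 <= beta ^+ 2 / 4.
  have -> : \sum_(j <- ts) (j / k ^+ 2)^-1 = k ^+ 2 * \sum_(j <- ts) j^-1.
    by rewrite mulr_sumr; apply: eq_bigr => t _; rewrite invf_div.
  have -> : beta ^+ 2 / 4 = k ^+ 2 * N%:R ^+ 2 by rewrite /k; field; rewrite gt_eqF.
  by rewrite ler_pM2l ?exprn_gt0.
have W_ge : 2 * beta / eps <= (1 + beta^-1) ^+ n.
  apply: le_trans (pow_1Dinv_ge _ n _ beta1).
  rewrite -[leLHS]lnK ?posrE ?divr_gt0 ?mulr_gt0 // ler_expR ler_pdivlMr ?mulr_gt0 //.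
  by rewrite mulrC.
have W_gt0 : 0 < (1 + beta^-1) ^+ n by rewrite exprn_gt0 // addr_gt0 ?invr_gt0.
have {}SP : `|S - q.[x ^+ 2]| <= 2 / (1 + beta^-1) ^+ n * (beta ^+ 2 / 4).
  rewrite (_ : 2 * (2 * beta)^-1 = beta^-1) in SP; last by field; rewrite gt_eqF.
  by apply: le_trans SP _; rewrite ler_pM2l // divr_gt0.
apply: le_trans (_ : 2 / beta * (2 / (1 + beta^-1) ^+ n * (beta ^+ 2 / 4)) <= _).
  rewrite ler_pM2l ?divr_gt0 //; apply: le_trans SP.
  by rewrite ler_piMl.
move: W_ge W_gt0; set W := _ ^+ n => W_ge W_gt0.
(* The remaining error beta / W is at most eps / 2 because W >= 2 beta / eps. *)
have -> : 2 / beta * (2 / W * (beta ^+ 2 / 4)) = beta / W.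
  by field; rewrite !gt_eqF.
move: W_ge; rewrite !ler_pdivrMr //; lra.
Qed.


(* There is an absolute constant C > 0 such that for all beta >= 1 and
   eps in (0,1) there is a polynomial p of degree <= C * beta * ln(beta/eps)
   with sup_{[-1,1]} |f - p| <= eps and sup_{[-1,1]} |p| <= 1 + eps. *)
Theorem theorem2 (R : realType) :
  exists C : R, 0 < C /\
  forall beta eps : R, 1 <= beta -> 0 < eps -> eps < 1 ->
  exists p : {poly R},
    ((size p).-1)%:R <= C * beta * ln (beta / eps) /\
    (forall x : R, -1 <= x <= 1 -> `|fermi_dirac beta x - p.[x]| <= eps) /\
    (forall x : R, -1 <= x <= 1 -> `|p.[x]| <= 1 + eps).
Proof.
(* With L = ln(beta / eps) >= ln 2 >= 1/2, the degree is at most 2 n + 1 <= 4 beta (ln 2 + L) + 3 <=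
   8 beta L + 6 beta L. *)
exists 14; split=> // beta eps beta1 eps_gt0 eps_lt1.
suff [p p_size pP] : exists2 p : {poly R},
    ((size p).-1)%:R <= 14 * beta * ln (beta / eps) &
    forall x : R, -1 <= x <= 1 -> `|fermi_dirac beta x - p.[x]| <= eps.
  exists p; split=> //; split=> // x /pP; rewrite !ler_norml.
  by have := fermi_dirac_bounds R beta x; lra.
have beta_gt0 : 0 < beta by lra.
(* For eps >= 1/2, where L may be close to 0, the constant 1/2 suffices as 0 < f < 1. Otherwise beta
   / eps >= 2, which gives L >= ln 2. *)
have [eps_ge|eps_lt] := leP 2^-1 eps.
  exists 2^-1%:P => [|x _].
    rewrite size_polyC invr_eq0 pnatr_eq0 /= mulr_ge0 //; first by lra.
    by rewrite ln_ge0 // ler_pdivlMr //; lra.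
  rewrite hornerC ler_norml.
  by have := fermi_dirac_bounds R beta x; lra.
pose n := (Num.truncn (2 * beta * ln (2 * beta / eps))).+1.
have [|p p_size pP] := @fermi_dirac_poly_approx R beta eps n beta1 eps_gt0 (ltW eps_lt1).
  exact: ltW (truncnS_gt _).
exists p => //.
have L_ge : ln 2 <= ln (beta / eps).
  by rewrite ler_ln ?posrE ?divr_gt0 // ler_pdivlMr //; lra.
have ln2 := ln2_ge_half R.
have Esum : ln (2 * beta / eps) = ln 2 + ln (beta / eps).
  by rewrite -mulrA lnM ?posrE ?divr_gt0.
have n_le : n%:R <= 2 * beta * ln (2 * beta / eps) + 1.
  rewrite /n -natr1 lerD2r truncn_le // Esum mulr_ge0 //; lra.
have size_le : ((size p).-1)%:R <= 2 * n%:R + 1 :> R.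
  by rewrite -natrM natr1 ler_nat; move: p_size; case: (size p).
move: n_le; rewrite Esum; nra.
Qed.
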